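(* The equality \[\lim_{n\rightarrow\infty}\left(u_n(321)\right)^{1/n}=4\] holds.
   Context: An increasing subsequence of a permutation $p=p_1p_2\cdots p_n$ is a set of entries $p_{j_1}<p_{j_2}<\cdots<p_{j_k}$ with $j_1<j_2<\cdots<j_k$ (positions need not be consecutive). The permutation $p$ has a unique longest increasing subsequence (ULIS) if it has an increasing subsequence that is longer than all its other increasing subsequences. A permutation $p$ contains the pattern $q=q_1\cdots q_k$ if there are indices $i_1<\cdots<i_k$ such that $p_{i_r}<p_{i_s}$ if and only if $q_r<q_s$; otherwise $p$ avoids $q$. For a pattern $q$, $u_n(q)$ denotes the number of permutations of length $n$ that avoid $q$ and have a ULIS. *)

(* Defs.v *)
From mathcomp Require Import all_boot all_order all_fingroup all_algebra.
From mathcomp Require Import all_classical all_reals all_analysis.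
Set Implicit Arguments.
Unset Strict Implicit.
Unset Printing Implicit Defensive.

(* A permutation of length n is p : 'S_n, in one-line notation p 0, ..., p n.-1:
   positions and values are numbered from 0. *)

(* A subsequence is given by its set of positions; as p is injective this is
   the same data as its set of entries, with the same cardinality. *)
Definition increasing_subseq (n : nat) (p : 'S_n) (A : {set 'I_n}) : bool :=
  [forall i in A, forall j in A, (i < j) ==> (p i < p j)].

Definition has_ULIS (n : nat) (p : 'S_n) : bool :=
  [exists A : {set 'I_n}, increasing_subseq p A &&
    [forall B : {set 'I_n},
       increasing_subseq p B && (B != A) ==> (#|B| < #|A|)]].

Definition contains (n k : nat) (p : 'S_n) (q : 'S_k) : bool :=
  [exists i : {ffun 'I_k -> 'I_n},
    [forall r : 'I_k, forall s : 'I_k, (r < s) ==> (i r < i s)] &&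
    [forall r : 'I_k, forall s : 'I_k, (p (i r) < p (i s)) == (q r < q s)]].

Definition avoids (n k : nat) (p : 'S_n) (q : 'S_k) : bool := ~~ contains p q.

Definition u (n k : nat) (q : 'S_k) : nat :=
  #|[set p : 'S_n | avoids p q && has_ULIS p]|.

(* 321, i.e. 2 1 0 with values numbered from 0: rev_ord i = 2 - i. *)
Definition pattern321 : 'S_3 := perm (@rev_ord_inj 3).

(* Main.v *)
Require Import Defs.
From mathcomp Require Import all_boot all_order all_fingroup all_algebra.
From mathcomp Require Import all_classical all_reals all_analysis.
From mathcomp Require Import zify.
Import mathcomp.boot.fintype mathcomp.boot.finset.
Import numFieldNormedType.Exports.
Set Implicit Arguments.
Unset Strict Implicit.
Unset Printing Implicit Defensive.
Import Order.TTheory GRing.Theory Num.Theory.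

(** The root limit follows from the two-sided estimate
      4 ^ n / (16 n ^ 4) <= u_n(321) <= 4 ^ n.

    Upper bound ([card_avoids321]). In a 321-avoiding permutation both the
    left-to-right maxima and the other entries increase. A permutation that
    increases on a set A of positions and on its complement is determined by A
    and the set B of values taken on A, and there are 2 ^ n * 2 ^ n pairs (A, B).

    Lower bound. Conversely every pair (A, B) with #|A| = #|B| comes from a
    permutation p that increases on A and on its complement, and p avoids 321
    by the pigeonhole principle. Call the entries at A upper and the others
    lower. Suppose that, for each t, the t-th lower entry forms an inversion
    both with the t-th and with the (t+1)-st upper entry. An increasing
    subsequence C contains at most one entry of each inversion, so the shift by
    0 and the shift by 1 both send the lower entries of C injectively to upper
    entries outside C. Hence #|C| <= #|A|; in case of equality both shifts have
    the same image, which is impossible unless C has no lower entry, that is,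
    C = A ([strict_LIS_of_matchings]). So p has a ULIS, namely A, and p
    determines (A, B).

    With U for upper and L for lower, the inversions exist as soon as the word
    of positions is U^c v and the word of values is w U^c, where c > 0, v is a
    Dyck word and w is a Dyck word with its letters exchanged. Thus
    u_(2k+c)(321) is at least the square of the number of Dyck words of length
    2k ([leq_dyck_u]). Every balanced word is a rotation of a Dyck word, so
    there are at least C(2k, k) / (2k+1) >= 4 ^ k / (2k+1) ^ 2 of these
    ([leq_pow4_dyck]). Taking c in {1, 2} covers all lengths n > 0, and the
    polynomial factor disappears in the n-th root ([cvg_root_of_bounds]). *)

(** * Ranks and enumerations of sets of ordinals *)

Definition rank (n : nat) (A : {set 'I_n}) (x : 'I_n) : nat :=
  #|[set j in A | j < x]|.

Lemma ltOrdE (n : nat) (i j : 'I_n) : (i < j)%O = (i < j).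
Proof. by rewrite ltEord. Qed.

Lemma sorted_enum_ord (n : nat) (A : {set 'I_n}) :
  sorted <%O (enum A).
Proof.
rewrite {1}/enum_mem; apply: sorted_filter; first exact: lt_trans.
rewrite -enumT.
have := iota_ltn_sorted 0 n; rewrite -val_enum_ord sorted_map.
by rewrite (eq_sorted (e' := <%O)) // => i j; rewrite ltOrdE.
Qed.

Lemma count_enum_ord (n : nat) (A : {set 'I_n}) (x : 'I_n) :
  count (fun j => (j < x)%O) (enum A) = rank A x.
Proof.
rewrite /rank cardE -size_filter {1}/enum_mem -filter_predI; congr size.
by rewrite /enum_mem; apply: eq_filter => j /=; rewrite !inE andbC ltOrdE.
Qed.

Lemma index_enum_rank (n : nat) (A : {set 'I_n}) (x : 'I_n) :
  x \in A -> index x (enum A) = rank A x.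
Proof.
move=> xA; rewrite -count_enum_ord.
have xs : x \in enum A by rewrite mem_enum.
rewrite -{2}(nth_index x xs) count_lt_nth ?index_mem //.
exact: sorted_enum_ord.
Qed.

Lemma nth_enum_lt (n : nat) (A : {set 'I_n}) (i0 x : 'I_n) t :
  t < rank A x -> nth i0 (enum A) t < x.
Proof.
rewrite -count_enum_ord => tr; rewrite -ltOrdE; apply: nth_count_lt => //.
by apply: sub_sorted (sorted_enum_ord A) => i j; apply: ltW.
Qed.

Lemma rank_lt (n : nat) (A : {set 'I_n}) (x y : 'I_n) :
  x \in A -> x < y -> rank A x < rank A y.
Proof.
move=> xA xy; rewrite /rank; apply: proper_card; apply/properP; split.
  by apply/subsetP => k; rewrite !inE => /andP[-> /ltn_trans]; apply.
by exists x; rewrite !inE xA ?xy // ltnn.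
Qed.

Lemma nth_enum_gt (n : nat) (A : {set 'I_n}) (i0 x : 'I_n) t :
  x \notin A -> rank A x <= t -> t < #|A| -> x < nth i0 (enum A) t.
Proof.
move=> xA rt tA; set y := nth _ _ _.
have yA : y \in A by rewrite -mem_enum mem_nth // -cardE.
have ry : rank A y = t by rewrite -index_enum_rank // index_uniq ?enum_uniq -?cardE.
have xy : x != y by apply: contraNneq xA => ->.
rewrite ltn_neqAle xy /= leqNgt; apply: contraL rt => yx.
by rewrite -ltnNge -ry rank_lt.
Qed.

(** * Permutations with prescribed upper positions and values *)

(** [has_ULIS p] is the existence of such an [A]; naming [A] lets the counting
    argument read it off from [p]. *)
Definition strict_LIS (n : nat) (p : 'S_n) (A : {set 'I_n}) : bool :=
  increasing_subseq p A &&
    [forall B : {set 'I_n},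
       increasing_subseq p B && (B != A) ==> (#|B| < #|A|)].

Lemma increasing_subseqP (n : nat) (p : 'S_n) (A : {set 'I_n}) :
  reflect {in A &, forall i j : 'I_n, i < j -> p i < p j}
          (increasing_subseq p A).
Proof.
apply: (iffP forall_inP) => [H i j iA jA ij | H i iA].
  by have /forall_inP/(_ j jA)/implyP := H i iA; apply.
by apply/forall_inP => j jA; apply/implyP; apply: H.
Qed.


Lemma strict_LIS_unique (n : nat) (p : 'S_n) (A B : {set 'I_n}) :
  strict_LIS p A -> strict_LIS p B -> A = B.
Proof.
case/andP=> iA /forallP/(_ B)/implyP HA /andP[iB /forallP/(_ A)/implyP HB].
apply/eqP/negPn/negP => AB.
have := HA; rewrite iB eq_sym AB => /(_ isT) BA.
by have := HB; rewrite iA AB => /(_ isT) /(ltn_trans BA); rewrite ltnn.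
Qed.

Lemma avoids321 (n : nat) (p : 'S_n) :
  reflect (forall a b c : 'I_n, a < b -> b < c -> p b < p a -> p c < p b -> False)
    (avoids p pattern321).
Proof.
apply: (iffP idP) => [av a b c ab bc pba pcb|H].
  case/negP: av; apply/existsP.
  exists [ffun r : 'I_3 => nth a [:: a; b; c] r].
  apply/andP; split; apply/forallP => -[[|[|[|r]]] ?] //; apply/forallP;
    case=> -[|[|[|s]]] ? //; rewrite !ffunE /pattern321 ?permE /= ?ltnn ?ab ?bc ?(ltn_trans ab bc) //.
  - by rewrite ltnNge ltnW.
  - by rewrite ltnNge ltnW // (ltn_trans pcb).
  - by rewrite pba.
  - by rewrite ltnNge ltnW.
  - by rewrite (ltn_trans pcb).
  - by rewrite pcb.
apply/negP => /existsP[i /andP[/forallP I1 /forallP I2]].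
pose o k (H : k < 3) : 'I_3 := Ordinal H.
pose o0 := o 0 isT; pose o1 := o 1 isT; pose o2 := o 2 isT.
apply: (H (i o0) (i o1) (i o2)).
- by have /forallP/(_ o1) := I1 o0.
- by have /forallP/(_ o2) := I1 o1.
- by have /forallP/(_ o0)/eqP -> := I2 o1; rewrite /pattern321 !permE.
- by have /forallP/(_ o1)/eqP -> := I2 o2; rewrite /pattern321 !permE.
Qed.

(** Of three entries, two lie in the same increasing part. *)
Lemma avoids321_union (n : nat) (p : 'S_n) (A : {set 'I_n}) :
  increasing_subseq p A -> increasing_subseq p (~: A) -> avoids p pattern321.
Proof.
move=> /increasing_subseqP iA /increasing_subseqP iC; apply/avoids321.
have inv (i j : 'I_n) : i < j -> p j < p i -> (i \in A) != (j \in A).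
  move=> ij; rewrite ltnNge; apply: contra => /eqP e; apply: ltnW.
  have [jA|jA] := boolP (j \in A); first by apply: iA => //; rewrite e.
  by apply: iC => //; rewrite inE ?e.
move=> a b c ab bc pba pcb.
have := inv _ _ (ltn_trans ab bc) (ltn_trans pcb pba).
by have := inv _ _ ab pba; have := inv _ _ bc pcb; do 3 case: (_ \in A).
Qed.

(** Each [x] outside [A] is inverted with both [f x] and [g x] (for [g x] because
    [f x < g x] in [A]), so [f] and [g] inject [C :\: A] into [A :\: C] for every
    increasing [C]. If [#|C| >= #|A|], both images are all of [A :\: C], although
    the positions [g x] have a larger sum than the positions [f x]. *)
Lemma strict_LIS_of_matchings (n : nat) (p : 'S_n) (A : {set 'I_n})
    (f g : 'I_n -> 'I_n) :
  increasing_subseq p A ->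
  {in ~: A &, injective f} -> {in ~: A &, injective g} ->
  (forall x, x \notin A ->
     [/\ f x \in A, g x \in A, f x < g x, g x < x & p x < p (f x)]) ->
  strict_LIS p A.
Proof.
move=> incA finj ginj fg; rewrite /strict_LIS incA /=.
apply/forallP => C; apply/implyP => /andP[/increasing_subseqP incC neqCA].
have /increasing_subseqP incA' := incA.
have subD : {subset C :\: A <= ~: A} by move=> x; rewrite !inE => /andP[].
have cf : #|f @: (C :\: A)| = #|C :\: A|.
  by apply: card_in_imset => x y /subD ? /subD ?; apply: finj.
have cg : #|g @: (C :\: A)| = #|C :\: A|.
  by apply: card_in_imset => x y /subD ? /subD ?; apply: ginj.
have sf : f @: (C :\: A) \subset A :\: C.
  apply/subsetP => _ /imsetP[x + ->]; rewrite !inE => /andP[xA xC].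
  have [fA _ fgx gx px] := fg x xA; rewrite fA andbT.
  apply: contraL px => fC; rewrite -leqNgt ltnW //.
  by apply: incC => //; apply: ltn_trans gx.
have sg : g @: (C :\: A) \subset A :\: C.
  apply/subsetP => _ /imsetP[x + ->]; rewrite !inE => /andP[xA xC].
  have [fA gA fgx gx px] := fg x xA; rewrite gA andbT.
  apply: contraL px => gC; rewrite -leqNgt ltnW //.
  by rewrite (ltn_trans (incA' _ _ fA gA fgx)) //; apply: incC.
rewrite -(cardsID A C) -(cardsID C A) setIC ltn_add2l ltn_neqAle -{2}cf.
rewrite (subset_leq_card sf) andbT; apply/eqP => e.
have ef : f @: (C :\: A) = A :\: C.
  by apply/eqP; rewrite eqEcard sf cf e leqnn.
have eg : g @: (C :\: A) = A :\: C.
  by apply/eqP; rewrite eqEcard sg cg e leqnn.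
have [D0|[x0 x0D]] := set_0Vmem (C :\: A).
  case/eqP: neqCA; apply/eqP; rewrite eqEsubset -!setD_eq0 D0 eqxx /=.
  by rewrite -cards_eq0 -e D0 cards0.
(* A nonempty [C :\: A] contradicts [ef] and [eg]. *)
have : \sum_(x in C :\: A) val (f x) < \sum_(x in C :\: A) val (g x).
  have fgD x : x \in C :\: A -> f x < g x.
    by rewrite inE => /andP[xA _]; have [] := fg x xA.
  rewrite (bigD1 x0) //= [X in _ < X](bigD1 x0) //= -addSn leq_add ?fgD //.
  by apply: leq_sum => x /andP[/fgD /ltnW].
rewrite -(big_imset (h := f) (fun y : 'I_n => val y)) /=; last first.
  by move=> x y /subD ? /subD ?; apply: finj.
rewrite -(big_imset (h := g) (fun y : 'I_n => val y)) /=; last first.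
  by move=> x y /subD ? /subD ?; apply: ginj.
by rewrite ef eg ltnn.
Qed.

Lemma exists_perm_of_sets (n : nat) (A B : {set 'I_n}) : #|A| = #|B| ->
  exists p : 'S_n,
    map p (enum A) = enum B /\
    map p (enum (~: A)) = enum (~: B).
Proof.
move=> AB; pose e (C : {set 'I_n}) := enum C ++ enum (~: C).
have ue C : uniq (e C).
  rewrite cat_uniq !enum_uniq andbT /=; apply/hasPn => x.
  by rewrite !mem_enum inE.
have se C : size (e C) = n by rewrite size_cat -!cardE cardsC card_ord.
have me C x : x \in e C by rewrite mem_cat !mem_enum inE orbN.
pose f x := nth x (e B) (index x (e A)).
have lt_i x : index x (e A) < size (e B) by rewrite se -[X in _ < X](se A) index_mem.
have injf : injective f.
  move=> x y; rewrite /f (set_nth_default y) // => /eqP.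
  by rewrite nth_uniq // => /eqP; apply: (index_inj x); apply: me.
exists (perm injf).
have E : map (perm injf) (e A) = e B.
  (* A default value for [nth] exists only when n > 0. *)
  have [i0 _|n0] := pickP 'I_n; last first.
    have e0 C : e C = [::] by case: (e C) => // x; have := n0 x.
    by rewrite !e0.
  apply: (@eq_from_nth _ i0); rewrite size_map ?se // => i lt.
  rewrite (nth_map i0) ?se // permE /f index_uniq ?se //.
  by apply: set_nth_default; rewrite se.
move: E; rewrite /e map_cat => /eqP.
by rewrite eqseq_cat ?size_map -?cardE // => /andP[/eqP -> /eqP ->].
Qed.

Lemma increasing_map_enum (n : nat) (p : 'S_n) (A B : {set 'I_n}) :
  map p (enum A) = enum B -> increasing_subseq p A.
Proof.
move=> E; apply/increasing_subseqP => i j iA jA ij.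
have := sorted_enum_ord B; rewrite -E sorted_map => s.
rewrite -ltOrdE; apply: (sorted_ltn_index _ s); rewrite ?mem_enum //.
  by move=> x y z; apply: lt_trans.
by rewrite !index_enum_rank // rank_lt.
Qed.

(** The matchings send the element of rank t outside [A] to the elements of [A]
    of rank t and t+1. The first hypothesis puts the latter to the left of [x],
    the second makes the value of the former exceed that of [x]. *)
Lemma exists_321_avoider (n : nat) (A B : {set 'I_n}) :
  #|A| = #|B| ->
  (forall x, x \notin A -> (rank (~: A) x).+1 < rank A x) ->
  (forall y, y \notin B -> rank B y <= rank (~: B) y) ->
  exists p : 'S_n, [/\ avoids p pattern321, strict_LIS p A & p @: A = B].
Proof.
move=> AB hA hB; have [p [pA pC]] := exists_perm_of_sets AB.
have iA := increasing_map_enum pA; have iC := increasing_map_enum pC.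
exists p; split; first exact: avoids321_union iA iC.
- pose h d x := nth x (enum A) (rank (~: A) x + d).
  have lth d x : x \notin A -> d <= 1 -> rank (~: A) x + d < #|A|.
    move=> xA d1; have := hA x xA.
    have : rank A x <= #|A| by apply/subset_leq_card/subsetP=> j; rewrite inE => /andP[].
    move=> r1 r2; apply: leq_trans r1; apply: leq_ltn_trans r2.
    by rewrite -addn1 leq_add2l.
  have hin d : d <= 1 -> {in ~: A &, injective (h d)}.
    move=> d1 x y xA yA; rewrite /h (set_nth_default y) -?cardE ?lth -?in_setC //.
    move/eqP; rewrite nth_uniq ?enum_uniq -?cardE ?lth -?in_setC //.
    rewrite eqn_add2r -!index_enum_rank // => /eqP; apply: (index_inj x).
      by rewrite mem_enum.
    by rewrite mem_enum.
  apply: (strict_LIS_of_matchings iA (hin 0 isT) (hin 1 isT)).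
  move=> x xA; have l0 := lth 0 x xA isT; have l1 := lth 1 x xA isT.
  split.
  + by rewrite -mem_enum mem_nth -?cardE.
  + by rewrite -mem_enum mem_nth -?cardE.
  + rewrite -ltOrdE /h (lt_sorted_ltn_nth _ (sorted_enum_ord A)) ?inE -?cardE //.
    by rewrite ltn_add2l.
  + by apply: nth_enum_lt; rewrite addn1 hA.
  + have pxB : p x \notin B.
      have : p x \in enum (~: B).
        by rewrite -pC; apply: map_f; rewrite mem_enum inE.
      by rewrite mem_enum inE.
    have rx : rank (~: B) (p x) = rank (~: A) x.
      rewrite -!index_enum_rank ?inE // -pC index_map //; exact: perm_inj.
    rewrite /h addn0 in l0 *.
    rewrite -(nth_map _ (p x)) -?cardE // pA.
    by apply: nth_enum_gt => //; rewrite -?AB // -rx hB.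
- apply/setP => y; rewrite -[RHS]mem_enum -pA; apply/imsetP/mapP => -[x xA ->].
    by exists x; rewrite ?mem_enum.
  by exists x; rewrite -1?mem_enum.
Qed.

(** * At most 4 ^ n permutations avoid 321 *)

(** On a set where it increases, a permutation is determined by its image. *)
Lemma map_enum_increasing (n : nat) (p : 'S_n) (A : {set 'I_n}) :
  increasing_subseq p A -> map p (enum A) = enum (p @: A).
Proof.
move=> /increasing_subseqP iA.
apply: (irr_sorted_eq (leT := <%O : rel 'I_n)).
- exact: lt_trans.
- exact: ltxx.
- apply: (@homo_sorted_in _ _ (mem A) p <%O <%O); last exact: sorted_enum_ord.
    by move=> x y xA yA; rewrite !ltOrdE; apply: iA.
  by apply/allP => x; rewrite mem_enum.
- exact: sorted_enum_ord.
- move=> y; rewrite mem_enum; apply/mapP/imsetP => -[x xA ->]; exists x => //.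
    by rewrite -mem_enum.
  by rewrite mem_enum.
Qed.

Definition lr_maxima (n : nat) (p : 'S_n) : {set 'I_n} :=
  [set i : 'I_n | [forall j : 'I_n, (j < i) ==> (p j < p i)]].

Lemma increasing_lr_maxima (n : nat) (p : 'S_n) :
  increasing_subseq p (lr_maxima p).
Proof.
apply/increasing_subseqP => i j _; rewrite inE => /forallP/(_ i)/implyP h.
exact: h.
Qed.

(** A descent between two entries, the first of which has a larger entry to its
    left, would complete a 321. *)
Lemma increasing_non_lr_maxima (n : nat) (p : 'S_n) :
  avoids p pattern321 -> increasing_subseq p (~: lr_maxima p).
Proof.
move=> /avoids321 av; apply/increasing_subseqP => i j + _ ij.
rewrite !inE negb_forall => /existsP[h]; rewrite negb_imply => /andP[hi].
rewrite -leqNgt leq_eqVlt => /predU1P[/val_inj/perm_inj e|ih].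
  by rewrite e ltnn in hi.
rewrite ltnNge leq_eqVlt; apply/negP => /predU1P[/val_inj/perm_inj e|ji].
  by rewrite e ltnn in ij.
exact: (av h i j).
Qed.

Lemma card_avoids321 (n : nat) :
  #|[set p : 'S_n | avoids p pattern321]| <= 4 ^ n.
Proof.
pose S := [set p : 'S_n | avoids p pattern321].
pose F (p : 'S_n) := (lr_maxima p, p @: lr_maxima p).
have injF : {in S &, injective F}.
  move=> p q; rewrite !inE => avp avq [eA eB].
  have iC := increasing_non_lr_maxima avp.
  have iD := increasing_non_lr_maxima avq.
  have iA := increasing_lr_maxima p; have iB := increasing_lr_maxima q.
  have imC (r : 'S_n) (A : {set 'I_n}) : r @: (~: A) = ~: (r @: A).
    apply/setP => y; rewrite inE -(permKV r y) !mem_imset ?inE //; exact: perm_inj.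
  have e1 : map p (enum (lr_maxima p)) = map q (enum (lr_maxima p)).
    by rewrite {2}eA !map_enum_increasing // eB.
  have e2 : map p (enum (~: lr_maxima p)) = map q (enum (~: lr_maxima p)).
    by rewrite {2}eA !map_enum_increasing // !imC eB.
  apply/permP => x; have [xA|xA] := boolP (x \in lr_maxima p).
    by move/eq_in_map: e1; apply; rewrite mem_enum.
  by move/eq_in_map: e2; apply; rewrite mem_enum inE.
rewrite -/S -(card_in_imset injF); apply: leq_trans (max_card _) _.
rewrite card_prod.
have -> : #|{set 'I_n}| = 2 ^ n by rewrite -cardsT -powersetT card_powerset cardsT card_ord.
by rewrite -expnMn.
Qed.

Lemma leq_u_pow4 n : u n pattern321 <= 4 ^ n.
Proof.
apply: leq_trans (card_avoids321 n); apply: subset_leq_card.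
by apply/subsetP => p; rewrite !inE => /andP[].
Qed.

(** * Sets of ordinals as binary words *)

Definition word_set (n : nat) (w : seq bool) : {set 'I_n} :=
  [set i : 'I_n | nth false w i].

Lemma card_ord_nat (n : nat) (P : pred nat) :
  #|[set j : 'I_n | P j]| = count P (iota 0 n).
Proof.
rewrite cardE -size_filter -val_enum_ord filter_map size_map {1}/enum_mem.
rewrite /enum_mem -filter_predI; congr size; apply: eq_filter => j.
by rewrite /= !inE andbT.
Qed.

Lemma rank_word_set (n : nat) (w : seq bool) (x : 'I_n) : size w = n ->
  rank (word_set n w) x = count id (take x w).
Proof.
move=> sw; have xn : x <= size w by rewrite sw ltnW.
have -> : rank (word_set n w) x =
          #|[set j : 'I_n | nth false w j && (j < x)]|.
  by apply: eq_card => j; rewrite !inE.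
rewrite (@card_ord_nat n (fun j => nth false w j && (j < x))).
rewrite -(map_nth_iota0 false xn) count_map -[n in iota 0 n](subnKC (ltnW (ltn_ord x))).
rewrite iotaD count_cat [X in _ + X](@eq_in_count _ _ pred0).
  rewrite count_pred0 addn0; apply: eq_in_count => j.
  by rewrite mem_iota => /= ->; rewrite andbT.
by move=> j; rewrite mem_iota add0n => /andP[xj _] /=; rewrite ltnNge xj andbF.
Qed.

Lemma card_word_set (n : nat) (w : seq bool) : size w = n ->
  #|word_set n w| = count id w.
Proof.
move=> sw; rewrite card_ord_nat -sw -[w in RHS](mkseq_nth false) count_map.
exact: eq_count.
Qed.

Lemma setC_word_set (n : nat) (w : seq bool) : size w = n ->
  ~: word_set n w = word_set n (map negb w).
Proof.
by move=> sw; apply/setP => i; rewrite !inE (nth_map false) ?sw.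
Qed.

Lemma word_set_inj (n : nat) (v w : seq bool) :
  size v = n -> size w = n -> word_set n v = word_set n w -> v = w.
Proof.
move=> sv sw /setP e; apply: (@eq_from_nth _ false); rewrite ?sv ?sw // => i lt.
by have := e (Ordinal lt); rewrite !inE.
Qed.

(** * Counting Dyck words *)

Definition balanced (k : nat) : {set k.*2.-tuple bool} :=
  [set w : k.*2.-tuple bool | count id w == k].

(** Dyck words, with [true] as the up step. *)
Definition dyck (k : nat) : {set k.*2.-tuple bool} :=
  [set w in balanced k |
    [forall j : 'I_k.*2.+1, count negb (take j w) <= count id (take j w)]].

Lemma count_id_negb (s : seq bool) : count id s + count negb s = size s.
Proof. by rewrite -(count_predC id). Qed.

Lemma dyck_prefix k (w : k.*2.-tuple bool) j :
  w \in dyck k -> count negb (take j w) <= count id (take j w).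
Proof.
rewrite inE => /andP[bw /forallP pw].
have [lt|ge] := ltnP j k.*2.+1; first exact: (pw (Ordinal lt)).
have := pw ord_max; rewrite /= [in take k.*2 w]take_oversize ?size_tuple //.
by rewrite take_oversize // size_tuple -ltnS ltnW.
Qed.

Lemma dyck_count k (w : k.*2.-tuple bool) : w \in dyck k ->
  count id w = k /\ count negb w = k.
Proof.
rewrite !inE => /andP[/eqP b _]; split=> //.
by have := count_id_negb w; rewrite b size_tuple; lia.
Qed.

(** Rotate to the place where the height of the path is smallest: the height then
    never drops below its starting value, also after wrapping around, because a
    balanced path ends at the height where it starts. Up to a constant, the
    height after [j] letters is the number of up steps before [j] plus the number
    of down steps after [j]; this form avoids subtraction. *)
Lemma rot_dyck k (w : k.*2.-tuple bool) : w \in balanced k ->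
  exists j : 'I_k.*2.+1, [tuple of rot j w] \in dyck k.
Proof.
rewrite inE => /eqP bw.
have bw' : count negb w = k.
  by have := count_id_negb w; rewrite bw size_tuple; lia.
pose f (j : nat) := count id (take j w) + count negb (drop j w).
(* [j] is a place of minimal height. *)
case: (@arg_minnP _ (@ord0 k.*2) xpredT (fun j : 'I_k.*2.+1 => f j)) => // j _.
move=> minf; have {}minf (i : nat) : i <= k.*2 -> f j <= f i.
  by move=> le; apply: (minf (Ordinal (le : i < k.*2.+1)) isT).
have bj : count id (rot j w) = k by apply: etrans bw; apply/seq.permP; rewrite perm_rot.
exists j; rewrite !inE /= bj eqxx /=; apply/forallP => i.
have jk : j <= k.*2 by rewrite -ltnS.
have ik : i <= k.*2 by rewrite -ltnS.
rewrite /rot take_cat size_drop size_tuple.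
have E (P : pred bool) (a : nat) : count P w = count P (take a w) + count P (drop a w).
  by rewrite -count_cat cat_take_drop.
have E1 := E id j; have E2 := E negb j.
case: ltnP => ij.
  have le : j + i <= k.*2 by lia.
  have := minf _ le; rewrite /f takeD (addnC (j : nat)) -drop_drop.
  rewrite count_cat.
  have : count negb (drop j w) = count negb (take i (drop j w)) + count negb (drop i (drop j w)).
    by rewrite -count_cat cat_take_drop.
  lia.
(* Here the prefix wraps around and ends at [i - (k.*2 - j)] in [w]. *)
have le : i - (k.*2 - j) <= j by lia.
rewrite take_takel // !count_cat.
have := minf _ (leq_trans le jk); rewrite /f.
have := E id (i - (k.*2 - j)); have := E negb (i - (k.*2 - j)).
lia.
Qed.

Lemma card_balanced k : #|balanced k| = 'C(k.*2, k).
Proof.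
have inj : {in balanced k &, injective (fun w : k.*2.-tuple bool => word_set k.*2 w)}.
  by move=> v w _ _ e; apply/val_inj/(word_set_inj _ _ e); rewrite size_tuple.
rewrite -(card_in_imset inj) -[X in 'C(X, _)]card_ord -card_draws.
apply: eq_card => A; rewrite inE; apply/imsetP/eqP => [[w + ->]|cA].
  by rewrite inE card_word_set ?size_tuple // => /eqP.
have e : word_set k.*2 [tuple i \in A | i < k.*2] = A.
  by apply/setP => i; rewrite inE -tnth_nth tnth_mktuple.
exists [tuple i \in A | i < k.*2] => //.
by rewrite inE -(@card_word_set k.*2) ?size_tuple // e cA.
Qed.

Lemma leq_balanced_dyck k : #|balanced k| <= k.*2.+1 * #|dyck k|.
Proof.
pose F (z : 'I_k.*2.+1 * k.*2.-tuple bool) := [tuple of rotr z.1 z.2].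
have sub : balanced k \subset F @: setX setT (dyck k).
  apply/subsetP => w /rot_dyck[j dj]; apply/imsetP.
  exists (j, [tuple of rot j w]); first by rewrite !inE in dj *.
  by apply: val_inj; rewrite /= rotK.
apply: leq_trans (subset_leq_card sub) (leq_trans (leq_imset_card _ _) _).
by rewrite cardsX cardsT card_ord.
Qed.

Lemma leq_pow4_central_bin k : 4 ^ k <= k.*2.+1 * 'C(k.*2, k).
Proof.
elim: k => [|k IH]; first by rewrite bin0.
have h1 := mul_bin_diag k.*2.+2 k.
have h2 := mul_bin_diag k.*2.+1 k.
have h3 : 'C(k.*2.+1, k) = 'C(k.*2.+1, k.+1).
  by rewrite -bin_sub; [congr 'C(_, _); lia | lia].
rewrite /= in h1 h2; rewrite doubleS expnS.
have h4 : k.+1 * 'C(k.*2.+2, k.+1) = 2 * (k.*2.+1 * 'C(k.*2, k)).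
  by rewrite -h1 h3 h2 -doubleS -mul2n mulnA.
apply: (@leq_trans (2 * (k.+1 * 'C(k.*2.+2, k.+1)))); first by lia.
by rewrite mulnA leq_mul2r; apply/orP; right; lia.
Qed.

Lemma leq_pow4_dyck k : 4 ^ k <= k.*2.+1 ^ 2 * #|dyck k|.
Proof.
apply: leq_trans (leq_pow4_central_bin k) _.
by rewrite -card_balanced expnS expn1 -mulnA leq_mul2l leq_balanced_dyck orbT.
Qed.

(** * At least 4 ^ n / (16 n ^ 4) avoiders of 321 have a ULIS *)

(** The prefix of [v] ending with its t-th [false] has at least t letters [true],
    so with [nseq c true] in front at least t+1 of them precede that [false]. In
    [map negb w] at most t-1 letters [true] precede the t-th [false]. *)
Lemma dyck_pair_perm k c (v w : k.*2.-tuple bool) : 0 < c ->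
  v \in dyck k -> w \in dyck k ->
  exists p : 'S_(c + k.*2),
    [/\ avoids p pattern321,
        strict_LIS p (word_set (c + k.*2) (nseq c true ++ v)) &
        p @: word_set (c + k.*2) (nseq c true ++ v) =
        word_set (c + k.*2) (map negb w ++ nseq c true)].
Proof.
move=> c0 dv dw; have [v1 v2] := dyck_count dv; have [w1 w2] := dyck_count dw.
have sv : size (nseq c true ++ v) = c + k.*2 by rewrite size_cat size_nseq size_tuple.
have sw : size (map negb w ++ nseq c true) = c + k.*2.
  by rewrite size_cat size_map size_nseq size_tuple addnC.
apply: exists_321_avoider.
- rewrite !card_word_set // !count_cat count_map !count_nseq v1.
  by rewrite (eq_count (a2 := negb)) // w2 addnC.
- move=> x; rewrite inE nth_cat size_nseq.
  case: ltnP => [xc|cx nx]; first by rewrite nth_nseq xc.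
  rewrite setC_word_set // !rank_word_set ?size_map // -map_take count_map.
  rewrite take_cat size_nseq (ltnNge x) cx /= !count_cat !count_nseq /= mul0n mul1n add0n.
  have lx : x - c < size v by rewrite size_tuple; have := ltn_ord x; lia.
  have := dyck_prefix (x - c).+1 dv.
  rewrite (take_nth false lx) -cats1 !count_cat /= (negbTE nx) /=.
  rewrite (eq_count (a1 := preim negb id) (a2 := negb)) //; lia.
- move=> x; rewrite inE nth_cat size_map size_tuple.
  case: ltnP => [xk nx|cx]; last first.
    by rewrite nth_nseq; have := ltn_ord x; case: ifP => //; lia.
  rewrite setC_word_set // !rank_word_set ?size_map // -map_take count_map.
  rewrite take_cat size_map size_tuple xk -map_take !count_map.
  rewrite (eq_count (a1 := preim negb id) (a2 := negb)) //.
  rewrite (eq_count (a1 := preim negb _) (a2 := id)); last by case.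
  exact: dyck_prefix.
Qed.

(** The pair of words is recovered from the permutation: the first one from the
    positions of the longest increasing subsequence, the second from its
    values. *)
Lemma leq_dyck_u k c : 0 < c -> #|dyck k| ^ 2 <= u (c + k.*2) pattern321.
Proof.
move=> c0; set n := c + k.*2.
pose G (z : k.*2.-tuple bool * k.*2.-tuple bool) :=
  (word_set n (nseq c true ++ z.1), word_set n (map negb z.2 ++ nseq c true)).
have s1 (z : k.*2.-tuple bool) : size (nseq c true ++ z) = n.
  by rewrite size_cat size_nseq size_tuple.
have s2 (z : k.*2.-tuple bool) : size (map negb z ++ nseq c true) = n.
  by rewrite size_cat size_map size_nseq size_tuple addnC.
have injG : injective G.
  move=> [v w] [v' w'] [/(word_set_inj (s1 v) (s1 v'))/eqP].
  rewrite eqseq_cat // eqxx /= => /eqP/val_inj -> .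
  move=> /(word_set_inj (s2 w) (s2 w'))/eqP.
  rewrite eqseq_cat ?size_map ?size_tuple // => /andP[/eqP + _].
  by move/(inj_map (inv_inj negbK))/val_inj ->.
pose S := G @: setX (dyck k) (dyck k).
have <- : #|S| = #|dyck k| ^ 2 by rewrite card_imset // cardsX expnS expn1.
pose F (p : 'S_n) := let A := odflt set0 [pick A | strict_LIS p A] in (A, p @: A).
apply: leq_trans (leq_imset_card F _); apply: subset_leq_card.
apply/subsetP => _ /imsetP[[v w] /setXP[/= dv dw] ->].
have [p [av st im]] := dyck_pair_perm c0 dv dw.
apply/imsetP; exists p.
  by rewrite inE av; apply/existsP; eexists; exact: st.
rewrite /F /G /=; case: pickP => [A sA|/(_ (word_set n (nseq c true ++ v)))].
  by rewrite /= (strict_LIS_unique sA st) im.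
by rewrite st.
Qed.

Lemma leq_pow4_u n : 0 < n -> 4 ^ n <= 16 * n ^ 4 * u n pattern321.
Proof.
move=> n0; pose k := n.-1./2; pose c := n - k.*2.
have c0 : 0 < c by rewrite /c /k; lia.
have nE : n = c + k.*2 by rewrite /c /k; lia.
have c2 : c <= 2 by rewrite /c /k; lia.
have kn : k.*2.+1 <= n by rewrite /k; lia.
(* The factor 16 is the largest value of [4 ^ c]. *)
apply: (@leq_trans (16 * (4 ^ k) ^ 2)).
  rewrite -expnM muln2 {1}nE expnD leq_mul2r; apply/orP; right.
  exact: (@leq_pexp2l 4 c 2).
rewrite -mulnA leq_mul2l /=.
apply: (@leq_trans (k.*2.+1 ^ 4 * #|dyck k| ^ 2)).
  by rewrite (expnM _ 2 2) -expnMn leq_exp2r // leq_pow4_dyck.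
apply: leq_mul; first by rewrite leq_exp2r.
by rewrite {1}nE leq_dyck_u.
Qed.

(** * The n-th root *)

Local Open Scope classical_set_scope.
Local Open Scope ring_scope.

(** Apply [ln s < s] to the square root of [n]. *)
Lemma cvg_ln_over_n (R : realType) : ln (n%:R : R) / n%:R @[n --> \oo] --> (0 : R).
Proof.
apply: (@squeeze_cvgr _ _ _ _ (fun=> 0) (fun n : nat => 2 * Num.sqrt (n%:R^-1 : R))).
- near=> n.
  have n0 : 0 < (n%:R : R) by rewrite ltr0n; near: n; exists 1%N.
  have s0 : 0 < Num.sqrt (n%:R : R) by rewrite sqrtr_gt0.
  have sE : (n%:R : R) = Num.sqrt n%:R ^+ 2 by rewrite sqr_sqrtr // ltW.
  apply/andP; split.
    by rewrite divr_ge0 ?(ltW n0) // ln_ge0 // ler1n -(ltr0n R).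
  rewrite ler_pdivrMr // {1}sE lnXn //.
  rewrite [X in _ <= X](_ : _ = Num.sqrt (n%:R) *+ 2).
    by rewrite ler_pMn2r // ltW // ln_sublinear.
  rewrite sqrtrV ?(ltW n0) // [X in _ * X]sE -mulrA expr2 mulKf ?gt_eqF //.
  by rewrite mulr_natl.
- exact: cvg_cst.
- rewrite -[0 in X in _ --> X](mulr0 2); apply: cvgMr.
  rewrite -[0 in X in _ --> X]sqrtr0.
  apply: continuous_cvg; first exact: sqrt_continuous.
  apply/gtr0_cvgV0; last exact: cvgr_idn.
  by near=> n; rewrite ltr0n; near: n; exists 1%N.
Unshelve. all: end_near. Qed.

Lemma cvg_root_of_bounds (R : realType) (a : nat -> nat) (b C d : nat) :
  (0 < b)%N -> (0 < C)%N ->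
  (forall n, (0 < n)%N -> (b ^ n <= C * n ^ d * a n)%N) ->
  (forall n, (0 < n)%N -> (a n <= b ^ n)%N) ->
  ((a n)%:R : R) `^ (n%:R^-1) @[n --> \oo] --> (b%:R : R).
Proof.
move=> b0 C0 lo up.
(* [l n] is the logarithm of the n-th root of [b ^ n / (C * n ^ d)]. *)
pose l (n : nat) : R := ln b%:R - (ln C%:R * n%:R^-1 + d%:R * (ln n%:R / n%:R)).
have Vn : (n%:R^-1 : R) @[n --> \oo] --> (0 : R).
  apply/gtr0_cvgV0; last exact: cvgr_idn.
  by near=> n; rewrite ltr0n; near: n; exists 1%N.
apply: (@squeeze_cvgr _ _ _ _ (expR \o l) (fun=> b%:R)).
- near=> n.
  have n0 : (0 < n)%N by near: n; exists 1%N.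
  have nR : 0 < (n%:R : R) by rewrite ltr0n.
  have bR : 0 < (b%:R : R) by rewrite ltr0n.
  have CR : 0 < (C%:R : R) by rewrite ltr0n.
  have an : (0 < a n)%N.
    have : (0 < b ^ n)%N by rewrite expn_gt0 b0.
    by move=> /leq_trans/(_ (lo n n0)); rewrite muln_gt0 => /andP[].
  have aR : 0 < ((a n)%:R : R) by rewrite ltr0n.
  have up' : ln ((a n)%:R : R) <= n%:R * ln b%:R.
    rewrite mulr_natl -lnXn // ler_ln ?posrE ?exprn_gt0 // -natrX ler_nat.
    exact: up.
  have lo' : n%:R * ln b%:R <= ln C%:R + d%:R * ln n%:R + ln ((a n)%:R : R).
    rewrite !mulr_natl -!lnXn // -!lnM ?posrE ?mulr_gt0 ?exprn_gt0 //.
    rewrite ler_ln ?posrE ?mulr_gt0 ?exprn_gt0 // -!natrX -!natrM ler_nat.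
    exact: lo.
  rewrite /powR gt_eqF //= -[X in _ <= _ <= X](lnK (x := b%:R)) ?posrE //.
  rewrite !ler_expR; apply/andP; split.
    rewrite /l lerBlDr mulrA -mulrDl mulrC -mulrDl.
    by rewrite ler_pdivlMr // mulrC addrC.
  by rewrite ler_pdivrMl.
- rewrite -[b%:R in X in _ --> X](lnK (x := b%:R)) ?posrE ?ltr0n //.
  apply: continuous_cvg; first exact: continuous_expR.
  rewrite -[X in _ --> X]subr0; apply: cvgB; first exact: cvg_cst.
  rewrite -[0 in X in _ --> X](addr0 0); apply: cvgD.
    by rewrite -[0 in X in _ --> X](mulr0 (ln C%:R)); apply: cvgMr.
  by rewrite -[0 in X in _ --> X](mulr0 d%:R); apply: cvgMr; exact: cvg_ln_over_n.
- exact: cvg_cst.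
Unshelve. all: end_near. Qed.

Theorem theorem4p6 (R : realType) :
  (fun n : nat => (u n pattern321)%:R `^ (n%:R^-1) : R) @ \oo --> (4 : R).
Proof.
apply: (@cvg_root_of_bounds R (fun n => u n pattern321) 4 16 4) => // n n0.
  exact: leq_pow4_u.
exact: leq_u_pow4.
Qed.
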